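(* Let $p$ be a prime and let $Q \in \mathbb{Z}[x]$ be a monic polynomial of degree $d \geq 2$ that is irreducible over $\mathbb{Z}_p$. Let $\alpha \geq 0$ be the largest non-negative integer such that $Q(x) \equiv 0 \mod p^{\alpha}$ for some $x \in \mathbb{Z}$. Then the sequence $V_p(Q) = \{\nu_p(Q(n)) : n \in \mathbb{N}\}$ is periodic with period length $p^{\lceil \alpha/d \rceil}$.
   Context: $\mathbb{N} = \{0,1,2,\dots\}$. For a prime $p$ and a nonzero integer $m$, $\nu_p(m)$ is the exponent of the highest power of $p$ dividing $m$. $\mathbb{Z}_p$ is the ring of $p$-adic integers; ''irreducible over $\mathbb{Z}_p$'' means irreducible in $\mathbb{Z}_p[x]$. ''Period length'' means the minimal period length: the least integer $T \geq 1$ such that $\nu_p(Q(n+T)) = \nu_p(Q(n))$ for all $n \in \mathbb{N}$. *)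

(* Defs.v *)
From HB Require Import structures.
From mathcomp Require Import all_boot all_order all_algebra.
From mathcomp Require Import boolp classical_sets.

Set Implicit Arguments.
Unset Strict Implicit.
Unset Printing Implicit Defensive.

Import Order.TTheory GRing.Theory Num.Theory.
Local Open Scope ring_scope.

(* The p-adic integers as the inverse limit of the rings Z/p^n: an element is
   a coherent sequence whose n-th term is the canonical representative, in
   [0, p^n), of its class modulo p^n.  The coherence condition already forces
   each term to lie in that range.  The primality proof is a parameter so that
   the integral domain structure can be inferred. *)
Record padic_int (p : nat) (p_pr : prime p) : Type := PadicInt {
  padic_res :> nat -> int;
  padic_resP : forall n, padic_res n = (padic_res n.+1 %% (p%:Z ^+ n))%Z
}.

Section PadicIntRing.
Variables (p : nat) (p_pr : prime p).
Local Notation Zp := (padic_int p_pr).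
Local Notation "a =[ n ] b" := (a = b %[mod (p%:Z ^+ n)])%Z
  (at level 70, n at level 0, b at level 69).

Lemma padic_ext (x y : Zp) : x =1 y -> x = y.
Proof.
case: x y => [x xP] [y yP] /= /funext xy; move: xP yP; rewrite {}xy => xP yP.
by congr PadicInt; exact: Prop_irrelevance.
Qed.

HB.instance Definition _ := gen_eqMixin Zp.
HB.instance Definition _ := gen_choiceMixin Zp.

Lemma modz_expS (a : int) n :
  ((a %% (p%:Z ^+ n.+1))%Z %% (p%:Z ^+ n))%Z = (a %% (p%:Z ^+ n))%Z.
Proof.
rewrite [in RHS](divz_eq a (p%:Z ^+ n.+1)) exprS [X in (X + _)%R]mulrA.
by rewrite modzMDl.
Qed.

Lemma padic_res_mod (x : Zp) n : (x n %% (p%:Z ^+ n))%Z = x n.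
Proof. by rewrite (padic_resP x n) modz_mod. Qed.

Lemma padic_resS (x : Zp) n : x n.+1 =[n] x n.
Proof. by rewrite [in RHS](padic_resP x n) modz_mod. Qed.

Lemma padic_of_seq_subproof (f : nat -> int) :
    (forall n, f n.+1 =[n] f n) ->
  forall n, (f n %% (p%:Z ^+ n))%Z
          = ((f n.+1 %% (p%:Z ^+ n.+1))%Z %% (p%:Z ^+ n))%Z.
Proof. by move=> fP n; rewrite modz_expS fP. Qed.

Definition padic_of_seq (f : nat -> int) (fP : forall n, f n.+1 =[n] f n) : Zp :=
  PadicInt p_pr (padic_of_seq_subproof fP).

Lemma padic_add_subproof (x y : Zp) n : x n.+1 + y n.+1 =[n] x n + y n.
Proof. by rewrite -modzDm !padic_resS modzDm. Qed.

Lemma padic_opp_subproof (x : Zp) n : - x n.+1 =[n] - x n.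
Proof. by rewrite -modzNm padic_resS modzNm. Qed.

Lemma padic_mul_subproof (x y : Zp) n : x n.+1 * y n.+1 =[n] x n * y n.
Proof. by rewrite -modzMm !padic_resS modzMm. Qed.

Definition padic_zero : Zp := padic_of_seq (f := fun=> 0) (fun=> erefl).
Definition padic_one : Zp := padic_of_seq (f := fun=> 1) (fun=> erefl).
Definition padic_add (x y : Zp) : Zp := padic_of_seq (padic_add_subproof x y).
Definition padic_opp (x : Zp) : Zp := padic_of_seq (padic_opp_subproof x).
Definition padic_mul (x y : Zp) : Zp := padic_of_seq (padic_mul_subproof x y).

Lemma padic_addA : associative padic_add.
Proof. by move=> x y z; apply: padic_ext => n /=; rewrite modzDmr modzDml addrA. Qed.

Lemma padic_addC : commutative padic_add.
Proof. by move=> x y; apply: padic_ext => n /=; rewrite addrC. Qed.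

Lemma padic_add0 : left_id padic_zero padic_add.
Proof. by move=> x; apply: padic_ext => n /=; rewrite modzDml add0r padic_res_mod. Qed.

Lemma padic_addN : left_inverse padic_zero padic_opp padic_add.
Proof. by move=> x; apply: padic_ext => n /=; rewrite modzDml addNr. Qed.

HB.instance Definition _ :=
  GRing.isZmodule.Build Zp padic_addA padic_addC padic_add0 padic_addN.

Lemma padic_mulA : associative padic_mul.
Proof. by move=> x y z; apply: padic_ext => n /=; rewrite modzMmr modzMml mulrA. Qed.

Lemma padic_mulC : commutative padic_mul.
Proof. by move=> x y; apply: padic_ext => n /=; rewrite mulrC. Qed.

Lemma padic_mul1 : left_id padic_one padic_mul.
Proof. by move=> x; apply: padic_ext => n /=; rewrite modzMml mul1r padic_res_mod. Qed.

Lemma padic_mulDl : left_distributive padic_mul padic_add.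
Proof.
by move=> x y z; apply: padic_ext => n /=; rewrite modzMml modzDm mulrDl.
Qed.

Lemma padic_one_neq0 : padic_one != 0.
Proof.
apply/eqP => /(congr1 (fun x : Zp => x 1%N)) /=.
by rewrite expr1 !modz_small //= ?ltz_nat ?prime_gt1 ?prime_gt0.
Qed.

HB.instance Definition _ := GRing.Zmodule_isComNzRing.Build Zp
  padic_mulA padic_mulC padic_mul1 padic_mulDl padic_one_neq0.

Definition padic_unit : {pred Zp} := fun x => `[< exists y : Zp, y * x = 1 >].
Definition padic_inv (x : Zp) : Zp := xget x [set y | y * x = 1]%classic.

Lemma padic_mulV : {in padic_unit, left_inverse 1 padic_inv *%R}.
Proof. by move=> x /asboolP xU; apply: (xgetPex x xU). Qed.

Lemma padic_unitPl (x y : Zp) : y * x = 1 -> padic_unit x.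
Proof. by move=> yx; apply/asboolP; exists y. Qed.

Lemma padic_inv_out : {in [predC padic_unit], padic_inv =1 id}.
Proof.
by move=> x /asboolPn xNU; apply: xgetPN => y yx; apply: xNU; exists y.
Qed.

HB.instance Definition _ := GRing.ComNzRing_hasMulInverse.Build Zp
  padic_mulV padic_unitPl padic_inv_out.

Lemma padic_res_addn (x : Zp) n m : x (n + m)%N =[n] x n.
Proof.
elim: m => [|m IH]; first by rewrite addn0.
rewrite addnS -{}IH; have /eqP := padic_resS x (n + m).
rewrite eqz_mod_dvd exprD => dv; apply/eqP; rewrite eqz_mod_dvd.
exact: dvdz_trans (dvdz_mulr _ (dvdzz _)) dv.
Qed.

Lemma padic_res_dvd (x : Zp) n m : (p%:Z ^+ n %| x (n + m)%N)%Z = (x n == 0).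
Proof. by rewrite -(padic_res_mod x n) -(padic_res_addn x n m); apply/dvdz_mod0P/eqP. Qed.

Lemma padic_integral : GRing.integral_domain_axiom Zp.
Proof.
move=> x y xy0; apply/norP => -[/eqP x0 /eqP y0].
have nz (z : Zp) : z <> 0 -> exists n, z n != 0.
  move=> z0; apply: contrapT => /forallNP h; apply: z0; apply: padic_ext => n /=.
  by rewrite mod0z; apply/eqP/negPn/negP/h.
have [n xn] := nz x x0; have [m ym] := nz y y0.
have := congr1 (fun z : Zp => z (n + m)%N) xy0; rewrite /= mod0z.
move/dvdz_mod0P; move: xn ym; rewrite -(padic_res_dvd x n m).
rewrite -(padic_res_dvd y m n) [(m + n)%N]addnC.
rewrite !dvdzE !abszX abszM /=.
set a := absz _; set b := absz _.
have [->|a0] := posnP a; first by rewrite dvdn0.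
have [->|b0] := posnP b; first by rewrite dvdn0.
rewrite !pfactor_dvdn ?muln_gt0 ?a0 // lognM // -!ltnNge => an bm.
by rewrite leqNgt -addSn leq_add // ltnW.
Qed.

HB.instance Definition _ := GRing.ComUnitRing_isIntegral.Build Zp padic_integral.

End PadicIntRing.

(* [irreducible_poly] tests divisibility up to scalars, i.e. over the fraction
   field; this is irreducibility as an element of the ring itself. *)
Definition irreducible_elt (R : idomainType) (a : R) : Prop :=
  [/\ a != 0, a \isn't a GRing.unit &
      forall b c : R, a = b * c -> b \is a GRing.unit \/ c \is a GRing.unit].

Definition irreducible_over_padic_int (p : nat) (p_pr : prime p)
    (Q : {poly int}) : Prop :=
  irreducible_elt (map_poly (fun m : int => m%:~R : padic_int p_pr) Q).

(* The p-adic valuation of an integer; the value at 0 is a junk 0. *)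
Definition valz (p : nat) (m : int) : nat := logn p `|m|%N.

Definition is_period (u : nat -> nat) (T : nat) : Prop :=
  (1 <= T)%N /\ forall n, u (n + T)%N = u n.

Definition period_length (u : nat -> nat) (T : nat) : Prop :=
  is_period u T /\ forall S, is_period u S -> (T <= S)%N.

Definition has_root_mod (Q : {poly int}) (m : int) : Prop :=
  exists x : int, (Q.[x] = 0 %[mod m])%Z.

Definition largest (P : nat -> Prop) (a : nat) : Prop :=
  P a /\ forall b, P b -> (b <= a)%N.

(* Main.v *)
Require Import Defs.
From HB Require Import structures.
From mathcomp Require Import all_boot all_order all_algebra.
From mathcomp Require Import boolp.
From mathcomp Require Import zify ring.

Set Implicit Arguments.
Unset Strict Implicit.
Unset Printing Implicit Defensive.

Import Order.TTheory GRing.Theory Num.Theory.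
Local Open Scope ring_scope.

(** Fix [x0] with [v(Q(x0)) = alpha] and put [R(h) = Q(x0 + h)], with
coefficients [a_i].  If the Newton polygon of [R] had more than one slope, then
its last vertex [k] before [d], together with [x^k] and the quotient of [R] by
[x^k], would be the starting point of a weighted Hensel lifting, whose limit
factors [R] over the p-adic integers.  Hence
[d * v(a_i) >= alpha * (d - i)] for every [i].  Comparing the terms of [R(h)]
gives [v(Q(x0 + h)) = d * v(h)] as long as [d * v(h) < alpha]; otherwise
[p^alpha] divides [Q(x0 + h)], and maximality of [alpha] gives
[v(Q(x0 + h)) = alpha].  So, for [c] the least integer with [d * c >= alpha],
[v(Q(n))] is a function of [n - x0] modulo [p^c] that takes the value [alpha]
only on the zero class. *)

(** * Weighted divisibility of polynomials *)

Section WeightedDivisibility.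
Variables (p r s : nat).

(* The coefficient [c] of ['X^i] has weight at least [N] when [p] weighs [r]
   and ['X] weighs [s]; integer weights encode the rational slope [s / r]. *)
Definition cdvd (N i : nat) (c : int) : Prop :=
  exists2 m, (p%:Z ^+ m %| c)%Z & (N <= r * m + s * i)%N.

Definition wdvd (N : nat) (f : {poly int}) : Prop := forall i, cdvd N i f`_i.

Lemma cdvdD N i a b : cdvd N i a -> cdvd N i b -> cdvd N i (a + b).
Proof.
move=> [m ma Nm] [n nb Nn]; exists (minn m n).
  by rewrite rpredD // ?(dvdz_trans _ ma) ?(dvdz_trans _ nb) // dvdz_exp2l //
    ?geq_minl ?geq_minr.
by rewrite /minn; case: ifP.
Qed.

Lemma cdvd0 N i : (0 < r)%N -> cdvd N i 0.
Proof. by move=> r0; exists N; [rewrite dvdz0 | nia]. Qed.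

Lemma cdvdN N i a : cdvd N i a -> cdvd N i (- a).
Proof. by move=> [m ma Nm]; exists m => //; rewrite rpredN. Qed.

Lemma wdvdW N M f : (N <= M)%N -> wdvd M f -> wdvd N f.
Proof. by move=> NM fM i; have [m mf Mm] := fM i; exists m => //; lia. Qed.

Lemma wdvdD N f g : wdvd N f -> wdvd N g -> wdvd N (f + g).
Proof. by move=> fN gN i; rewrite coefD; apply: cdvdD. Qed.

Lemma wdvdB N f g : wdvd N f -> wdvd N g -> wdvd N (f - g).
Proof. by move=> fN gN i; rewrite coefB; apply/cdvdD/cdvdN. Qed.

Lemma wdvd0 N : (0 < r)%N -> wdvd N 0.
Proof. by move=> r0 i; rewrite coef0; apply: cdvd0. Qed.

Lemma wdvdM N M f g : (0 < r)%N ->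
  wdvd N f -> wdvd M g -> wdvd (N + M) (f * g).
Proof.
move=> r0 fN gM i; rewrite coefM; elim/big_ind: _ => [||j _].
- exact: cdvd0.
- exact: cdvdD.
have [m mf Nm] := fN j; have [n ng Mn] := gM (i - j)%N.
exists (m + n)%N; first by rewrite exprD dvdz_mul.
by have := ltn_ord j; nia.
Qed.

Lemma wdvd_drop k N f : wdvd (N + s * k) f -> wdvd N (drop_poly k f).
Proof.
move=> fN i; rewrite coef_drop_poly; have [m mf Nm] := fN (i + k)%N.
by exists m => //; nia.
Qed.

Lemma wdvdZXn N j c : (0 < r)%N -> cdvd N j c -> wdvd N (c *: 'X^j).
Proof.
move=> r0 cN i; rewrite coefZ coefXn; have [->|_] := eqVneq i j.
  by rewrite mulr1.
by rewrite mulr0; apply: cdvd0.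
Qed.

End WeightedDivisibility.

(** * Weighted Hensel lifting *)

Lemma modular_inverse (p : nat) (u : int) : prime p -> ~~ (p%:Z %| u)%Z ->
  exists v, (p%:Z %| 1 - v * u)%Z.
Proof.
move=> p_pr pu; have [v [w vw]] := Bezoutz u p%:Z.
have : gcdz u p%:Z = 1.
  have /eqP : coprime `|u| p by rewrite coprime_sym prime_coprime // -dvdzE.
  by rewrite /gcdz /= => ->.
move=> g1; exists v; apply/dvdzP; exists w; rewrite -g1 -vw; ring.
Qed.

Lemma size_mul_leq (R : nzRingType) (a b : {poly R}) k l :
  (size a <= k)%N -> (size b <= l.+1)%N -> (size (a * b)%R <= k + l)%N.
Proof.
case: k => [|k] sa sb; last by apply: leq_trans (size_polyMleq _ _) _; lia.
by move: sa; rewrite leqn0 size_poly_eq0 => /eqP ->; rewrite mul0r size_poly0.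
Qed.

Section WeightedHensel.
(* Weights: [p] weighs [l] and ['X] weighs [s]; the monic factor [H0] is then
   homogeneous up to higher weight, and its constant term [p ^ s * u] has
   exactly the weight [s * l] of [H0]. *)
Variables (p k l s : nat) (u : int) (H0 : {poly int}).
Hypotheses (p_pr : prime p) (l_gt0 : (0 < l)%N).
Hypotheses (H0_0 : H0`_0 = p%:Z ^+ s * u) (pu : ~~ (p%:Z %| u)%Z).
Hypotheses (sH0 : size H0 = l.+1) (wH0 : wdvd p l s (s * l) H0).
Let d := (k + l)%N.
Local Notation W := (wdvd p l s).

(* Coefficients of [g] are found from the lowest up: the constant term of [H0]
   is the only obstruction, and [u] is inverted only modulo [p], which already
   raises the weight of the remainder by [l]. *)
Lemma solve_low_terms j N E : (j <= k)%N -> (0 < N)%N -> W (s * d + N) E ->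
  exists g : {poly int}, [/\ (size g <= j)%N, W (s * k + N) g
              & W (s * d + N.+1) (take_poly j (E - g * H0))].
Proof.
move=> jk N0 wE; elim: j jk => [_|j IH jk].
  exists 0; rewrite size_poly0 take_poly0l; split => //; exact: wdvd0.
have [g [sg wg wF]] := IH (ltnW jk).
set F := E - g * H0 in wF.
have wF' : W (s * d + N) F.
  apply: wdvdB => //; apply: (@wdvdW _ _ _ _ ((s * k + N) + s * l)%N).
    by rewrite /d; lia.
  exact: wdvdM.
have [v pv] := modular_inverse p_pr pu.
have [m mF Nm] := wF' j.
(* Below index [k] the power of ['X] weighs at most [s * k], so [p ^ s] already divides the
   coefficient to cancel. *)
have sm : (s <= m)%N by rewrite /d in Nm; nia.
have /dvdzP[q qF] := mF.
set c := v * q * p%:Z ^+ (m - s).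
have cF : c * (p%:Z ^+ s * u) = v * u * F`_j.
  rewrite qF /c -[in RHS](subnK sm) exprD; ring.
have wc : W (s * k + N) (c *: 'X^j).
  apply: wdvdZXn => //; exists (m - s)%N; first by rewrite dvdz_mull.
  by move: Nm sm; rewrite /d; clear; nia.
exists (g + c *: 'X^j); split.
- rewrite (leq_trans (size_polyD _ _)) // geq_max (leq_trans sg) //=.
  by rewrite (leq_trans (size_scale_leq _ _)) // size_polyXn.
- exact: wdvdD.
have -> : E - (g + c *: 'X^j) * H0 = F - (c *: H0) * 'X^j.
  rewrite /F -!mul_polyC; ring.
move=> i; rewrite coef_take_poly; case: ifP => [ij|_]; last exact: cdvd0.
rewrite coefB coefMXn; case: ltnP => [ji|ji].
  by have := wF i; rewrite coef_take_poly ji subr0.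
have -> : i = j by lia.
rewrite subnn coefZ H0_0 cF -[X in X - _]mul1r -mulrBl.
exists m.+1; last by rewrite mulnS; lia.
by rewrite exprS dvdz_mul.
Qed.

(** [N] counts the weight gained by the error. The size bounds preserve the top terms of both
    factors; the strict weight bounds make cross terms gain weight. *)
Definition lift_inv (R : {poly int}) (N : nat) (gh : {poly int} * {poly int}) :=
  [/\ (size gh.1 <= k)%N /\ (size gh.2 <= l)%N, W (s * k).+1 gh.1,
      W (s * l).+1 gh.2
    & W (s * d + N.+1) (R - ('X^k + gh.1) * (H0 + gh.2))].

Lemma size_lift_error R N gh :
  (size (R - 'X^k * H0)%R <= d)%N -> lift_inv R N gh ->
  (size (R - ('X^k + gh.1) * (H0 + gh.2))%R <= d)%N.
Proof.
case: gh => g h sR [/= [sg sh] _ _ _].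
have sXh : (size ('X^k * h)%R <= d)%N.
  apply: leq_trans (size_polyMleq _ _) _.
  by rewrite size_polyXn /d addSn leq_add2l.
have -> : R - ('X^k + g) * (H0 + h) = R - 'X^k * H0 - 'X^k * h - g * (H0 + h).
  by ring.
rewrite (leq_trans (size_polyD _ _)) // geq_max size_polyN.
rewrite size_mul_leq ?andbT //.
  by rewrite (leq_trans (size_polyD _ _)) // geq_max size_polyN sR.
by rewrite (leq_trans (size_polyD _ _)) // geq_max sH0 leqnn leqW.
Qed.

(** A correction [g'] raises the weight of the error below index [k]; the rest is a multiple of
    ['X^k], cancelled by adding its quotient [h'] to the second factor. Only cross terms of higher
    weight are left besides. *)
Lemma lift_step R N gh :
  (size (R - 'X^k * H0)%R <= d)%N -> lift_inv R N gh ->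
  exists2 gh', lift_inv R N.+1 gh' &
    W (s * k + N.+1) (gh'.1 - gh.1) /\ W (s * l + N.+1) (gh'.2 - gh.2).
Proof.
move=> sR inv; have := size_lift_error sR inv.
case: gh inv => g h [/= [sg sh] wg wh]; set E := R - _ => wE sE.
have [g' [sg' wg' wF]] := solve_low_terms (leqnn k) (ltn0Sn N) wE.
set F := E - g' * H0 in wF.
have sF : (size F <= d)%N.
  rewrite (leq_trans (size_polyD _ _)) // geq_max size_polyN sE /=.
  rewrite size_mul_leq //.
  by rewrite sH0.
set h' := drop_poly k F.
have wF' : W (s * d + N.+1) F.
  apply: wdvdB => //; apply: (@wdvdW _ _ _ _ ((s * k + N.+1) + s * l)%N).
    by rewrite /d; lia.
  exact: wdvdM.
have wh' : W (s * l + N.+1) h'.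
  by apply: wdvd_drop; apply: wdvdW wF'; rewrite /d; lia.
exists (g + g', h + h'); last first.
  by split; rewrite /= addrC addKr.
split=> /=.
- split; rewrite (leq_trans (size_polyD _ _)) // geq_max ?sg ?sh //=.
  by rewrite size_drop_poly leq_subLR.
- by apply: wdvdD => //; apply: wdvdW wg'; lia.
- by apply: wdvdD => //; apply: wdvdW wh'; lia.
have -> : R - ('X^k + (g + g')) * (H0 + (h + h'))
        = take_poly k F - (g' * h + (g + g') * h').
  have -> : take_poly k F = F - h' * 'X^k.
    by rewrite -{2}(poly_take_drop k F) addrK.
  by rewrite /F /E; ring.
apply: wdvdB => //; apply: wdvdD.
  apply: (@wdvdW _ _ _ _ ((s * k + N.+1) + (s * l).+1)%N).
    by rewrite /d; lia.
  exact: wdvdM.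
apply: (@wdvdW _ _ _ _ ((s * k).+1 + (s * l + N.+1))%N).
  by rewrite /d; lia.
apply: wdvdM => //; apply: wdvdD => //; apply: wdvdW wg'; lia.
Qed.

Lemma lift_sequence R :
  (size (R - 'X^k * H0)%R <= d)%N -> W (s * d).+1 (R - 'X^k * H0) ->
  exists gh : nat -> {poly int} * {poly int}, forall N,
    [/\ lift_inv R N (gh N), W (s * k + N.+1) ((gh N.+1).1 - (gh N).1)
      & W (s * l + N.+1) ((gh N.+1).2 - (gh N).2)].
Proof.
move=> sR wR.
have inv0 : lift_inv R 0 (0, 0).
  split; rewrite /= ?size_poly0 ?addr0 ?addn1 //; exact: wdvd0.
have step (x : nat * ({poly int} * {poly int})) : exists gh',
    lift_inv R x.1 x.2 -> lift_inv R x.1.+1 gh' /\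
    (W (s * k + x.1.+1) (gh'.1 - x.2.1) /\ W (s * l + x.1.+1) (gh'.2 - x.2.2)).
  (* A dummy pair off the invariant makes the relation total for [choice]. *)
  case: (pselect (lift_inv R x.1 x.2)) => [inv|ninv]; last by exists (0, 0).
  by have [gh' inv' w] := lift_step sR inv; exists gh'.
have [F FP] := choice step.
pose gh := fix gh N := if N is N'.+1 then F (N', gh N') else (0, 0).
have inv N : lift_inv R N (gh N).
  by elim: N => [|N IH] //; have [] := FP (N, gh N) IH.
by exists gh => N; have [_ []] := FP (N, gh N) (inv N).
Qed.

End WeightedHensel.

(** * Limits of coherent polynomials *)

Section PadicLimits.
Variables (p : nat) (p_pr : prime p).
Local Notation Zp := (padic_int p_pr).

Lemma padic_resD (x y : Zp) n : (x + y) n = ((x n + y n) %% p%:Z ^+ n)%Z.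
Proof. by []. Qed.

Lemma padic_resM (x y : Zp) n : (x * y) n = ((x n * y n) %% p%:Z ^+ n)%Z.
Proof. by []. Qed.

Lemma padic_res0 n : (0 : Zp) n = 0.
Proof. exact: mod0z. Qed.

Lemma padic_res_intr (c : int) n : (c%:~R : Zp) n = (c %% p%:Z ^+ n)%Z.
Proof.
have nat_case (m : nat) : (m%:R : Zp) n = (m%:Z %% p%:Z ^+ n)%Z.
  elim: m => [|m IH]; first by rewrite padic_res0 mod0z.
  by rewrite -addn1 natrD padic_resD IH PoszD /= modzDm.
case: c => m; first exact: nat_case.
by rewrite NegzE mulrNz -[LHS]/((- (m.+1%:R : Zp) n %% p%:Z ^+ n)%Z)
  nat_case modzNm.
Qed.

Lemma padic_res_sum m (F : 'I_m -> Zp) (f : 'I_m -> int) n :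
    (forall i, F i n = (f i %% p%:Z ^+ n)%Z) ->
  (\sum_i F i) n = ((\sum_i f i) %% p%:Z ^+ n)%Z.
Proof.
move=> Ff; elim/big_ind2: _ => [|x a y b xa yb|i _]; last exact: Ff.
  by rewrite padic_res0 mod0z.
by rewrite padic_resD xa yb modzDm.
Qed.

(** Monicity makes the top coefficient of the limit equal to 1, so the degree does not drop. *)
Lemma padic_poly_limit (f : nat -> {poly int}) m :
    (forall n, f n \is monic) -> (forall n, size (f n) = m.+1) ->
    (forall n i, ((f n.+1)`_i = (f n)`_i %[mod p%:Z ^+ n])%Z) ->
  exists F : {poly Zp}, size F = m.+1 /\
    forall n i, F`_i n = ((f n)`_i %% p%:Z ^+ n)%Z.
Proof.
move=> fm sf fP.
pose c i : Zp := padic_of_seq p_pr (f := fun n => (f n)`_i) (fun n => fP n i).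
have cm : c m = 1.
  apply: padic_ext => n /=; move/monicP: (fm n).
  by rewrite /lead_coef sf /= => ->.
exists (\poly_(i < m.+1) c i); split.
  by rewrite size_poly_eq //= cm oner_neq0.
move=> n i; rewrite coef_poly; case: ltnP => // mi.
by rewrite padic_res0 nth_default ?mod0z // sf.
Qed.

Lemma padic_poly_mulP (F G : {poly Zp}) (R : {poly int})
    (f g : nat -> {poly int}) :
    (forall n i, F`_i n = ((f n)`_i %% p%:Z ^+ n)%Z) ->
    (forall n i, G`_i n = ((g n)`_i %% p%:Z ^+ n)%Z) ->
    (forall n i, (R`_i = (f n * g n)`_i %[mod p%:Z ^+ n])%Z) ->
  map_poly (fun m : int => m%:~R : Zp) R = F * G.
Proof.
move=> Ff Gg fgR; apply/polyP => i; rewrite coef_map_id0 // coefM.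
apply: padic_ext => n; rewrite padic_res_intr fgR coefM; apply/esym.
by apply: padic_res_sum => j; rewrite padic_resM Ff Gg modzMm.
Qed.

End PadicLimits.

(** * Factorization over the p-adic integers *)

Lemma wdvd_coef p r s n k (f : {poly int}) i : (0 < r)%N ->
  (size f <= k.+1)%N -> wdvd p r s (s * k + r * n) f -> (p%:Z ^+ n %| f`_i)%Z.
Proof.
move=> r0 sf wf; case: (leqP i k) => ik; last first.
  by rewrite nth_default ?dvdz0 // (leq_trans sf).
have [m mf Nm] := wf i; apply: dvdz_trans mf; rewrite dvdz_exp2l //.
by move: Nm ik r0; clear; nia.
Qed.

Lemma wdvd_telescope p r s a (f : nat -> {poly int}) N t : (0 < r)%N ->
  (forall n, wdvd p r s (a + n.+1) (f n.+1 - f n)) ->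
  wdvd p r s (a + N) (f (N + t)%N - f N).
Proof.
move=> r0 fP; elim: t => [|t IH]; first by rewrite addn0 subrr; apply: wdvd0.
rewrite addnS -(subrKA (f (N + t)%N)); apply: wdvdD => //.
apply: wdvdW (fP _); lia.
Qed.

Lemma weighted_hensel p (p_pr : prime p) k l s (u : int) (R H0 : {poly int}) :
    (0 < l)%N -> H0`_0 = p%:Z ^+ s * u -> ~~ (p%:Z %| u)%Z ->
    H0 \is monic -> size H0 = l.+1 -> wdvd p l s (s * l) H0 ->
    (size (R - 'X^k * H0)%R <= k + l)%N ->
    wdvd p l s (s * (k + l)).+1 (R - 'X^k * H0) ->
  exists G H : {poly padic_int p_pr},
    [/\ map_poly (fun m : int => m%:~R : padic_int p_pr) R = G * H,
        size G = k.+1 & size H = l.+1].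
Proof.
move=> l0 H0_0 pu H0m sH0 wH0 sR wR.
have [gh ghP] := lift_sequence p_pr l0 H0_0 pu sH0 wH0 sR wR.
have sg N : (size (gh N).1 <= k)%N by have [[[]]] := ghP N.
have sh N : (size (gh N).2 <= l)%N by have [[[]]] := ghP N.
(* As [p] weighs [l], one more power of [p] takes [l] lifting steps. *)
pose g n : {poly int} := 'X^k + (gh (l * n)%N).1.
pose h n : {poly int} := H0 + (gh (l * n)%N).2.
have coh m (F : {poly int}) (f : nat -> {poly int}) n i :
    (forall N, size (f N) <= m)%N ->
    (forall N, wdvd p l s (s * m + N.+1) (f N.+1 - f N)) ->
  ((F + f (l * n.+1)%N)`_i = (F + f (l * n)%N)`_i %[mod p%:Z ^+ n])%Z.
  move=> sf fP; apply/eqP; rewrite eqz_mod_dvd -coefB opprD addrACA subrr add0r.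
  apply: (@wdvd_coef _ l s _ m) => //.
    by rewrite leqW // (leq_trans (size_polyD _ _)) // geq_max size_polyN !sf.
  by rewrite mulnSr; apply: wdvd_telescope.
have [||n i|G [sG Gg]] := @padic_poly_limit _ p_pr g k.
- move=> n; rewrite monicE lead_coefDl ?lead_coefXn //.
  by rewrite size_polyXn ltnS.
- by move=> n; rewrite size_polyDl size_polyXn // ltnS.
- by apply: (coh k _ (fun N => (gh N).1)) => // N; have [] := ghP N.
have [||n i|H [sH Hh]] := @padic_poly_limit _ p_pr h l.
- by move=> n; rewrite monicE lead_coefDl ?(monicP H0m) // sH0 ltnS.
- by move=> n; rewrite size_polyDl sH0 // ltnS.
- by apply: (coh l _ (fun N => (gh N).2)) => // N; have [] := ghP N.
exists G, H; split=> //; apply: padic_poly_mulP Gg Hh _ => n i.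
apply/eqP; rewrite eqz_mod_dvd -coefB.
have [inv _ _] := ghP (l * n)%N; have := size_lift_error sH0 sR inv.
case: inv => _ _ _ wE sE.
apply: (@wdvd_coef _ l s _ (k + l)) => //; first exact: leqW.
by apply: wdvdW wE; lia.
Qed.

(** * Valuations, and irreducibility under translation *)

Lemma dvdz_valz p (c : int) n : prime p -> c != 0 ->
  (p%:Z ^+ n %| c)%Z = (n <= valz p c)%N.
Proof.
by move=> p_pr c0; rewrite dvdzE abszX pfactor_dvdn // absz_gt0.
Qed.

Lemma valz_eq p (c : int) n : prime p ->
  (p%:Z ^+ n %| c)%Z -> ~~ (p%:Z ^+ n.+1 %| c)%Z -> valz p c = n.
Proof.
move=> p_pr nc nSc; have c0 : c != 0.
  by apply: contraNneq nSc => ->; rewrite dvdz0.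
by move: nc nSc; rewrite !dvdz_valz // -ltnNge; lia.
Qed.

Lemma wdvd_valz p r s N (f : {poly int}) : prime p -> (0 < r)%N ->
  (forall i, f`_i != 0 -> (N <= r * valz p f`_i + s * i)%N) -> wdvd p r s N f.
Proof.
move=> p_pr r0 fN i; have [->|fi] := eqVneq f`_i 0; first exact: cdvd0.
by exists (valz p f`_i); [rewrite dvdz_valz | apply: fN].
Qed.

(** Composition with [y] undoes the translation and preserves sizes; a unit factor is a constant. *)
Lemma irreducible_padic_shift p (p_pr : prime p) (Q : {poly int}) (x : int)
    (G H : {poly padic_int p_pr}) :
    irreducible_over_padic_int p_pr Q ->
    map_poly (fun m : int => m%:~R : padic_int p_pr) (Q \Po ('X + x%:P))
      = G * H ->
  size G = 1 \/ size H = 1.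
Proof.
rewrite /irreducible_over_padic_int.
rewrite -[map_poly _ Q]/(map_poly intr Q) -[map_poly _ _]/(map_poly intr _).
case=> _ _ Qirr; rewrite map_comp_poly => QGH.
pose y : {poly padic_int p_pr} := 'X - (x%:~R)%:P.
have sy : size y = 2 by rewrite size_XsubC.
have Qy : map_poly intr Q = (G \Po y) * (H \Po y).
  rewrite -comp_polyM -QGH -comp_polyA rmorphD /= map_polyX map_polyC /=.
  by rewrite comp_polyD comp_polyX comp_polyC subrK comp_polyXr.
have [] := Qirr _ _ Qy; rewrite poly_unitE size_comp_poly2 // => /andP[/eqP sz _].
  by left.
by right.
Qed.

(** * The Newton polygon has one slope *)

Section SingleSlope.
Variables (p : nat) (p_pr : prime p) (R : {poly int}) (d : nat).
Hypotheses (Rm : R \is monic) (sR : size R = d.+1) (d_gt0 : (0 < d)%N).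
Hypothesis R0 : R`_0 != 0.
Local Notation v i := (valz p R`_i).

(* Taking the least index among the minimizers of [v i / (d - i)] makes the
   inequality strict below it. *)
Lemma lowest_slope_vertex : exists2 k, (k < d)%N /\ R`_k != 0 &
  (forall i, (i < d)%N -> R`_i != 0 -> (v k * (d - i) <= v i * (d - k))%N) /\
  (forall i, (i < k)%N -> R`_i != 0 -> (v k * (d - i) < v i * (d - k))%N).
Proof.
(* Minus the slope of the segment from [(i, v i)] to [(d, 0)], the point of the leading
   coefficient. *)
pose slope i : rat := (v i)%:R / (d - i)%:R.
have slopeE i j : (i < d)%N -> (j < d)%N ->
    (slope i <= slope j) = (v i * (d - j) <= v j * (d - i))%N.
  move=> id jd; rewrite /slope ler_pdivrMr ?ltr0n ?subn_gt0 // mulrAC.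
  by rewrite ler_pdivlMr ?ltr0n ?subn_gt0 // -!natrM ler_nat.
pose B k := [&& (k < d)%N, R`_k != 0 &
  [forall i : 'I_d, (R`_i != 0) ==> (slope k <= slope i)]].
have exB : exists k, B k.
  pose i0 := Ordinal d_gt0.
  have [i Ri imin] := @arg_minP _ _ _ i0 (fun i : 'I_d => R`_i != 0)
    (fun i => slope i) R0.
  exists i; rewrite /B ltn_ord Ri; apply/forallP => j; apply/implyP; exact: imin.
case: (ex_minnP exB) => k /and3P[kd Rk /forallP kmin] kleast.
have kslope i : (i < d)%N -> R`_i != 0 -> slope k <= slope i.
  by move=> id Ri; have /implyP := kmin (Ordinal id); apply.
exists k => //; split=> [i id Ri|i ik Ri]; first by rewrite -slopeE ?kslope.
have id := ltn_trans ik kd.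
rewrite ltnNge -slopeE //; apply/negP => ski.
suff /kleast : B i by rewrite leqNgt ik.
rewrite /B id Ri; apply/forallP => j; apply/implyP => Rj.
exact: le_trans ski (kslope _ _ _).
Qed.

Hypothesis R_irr : forall G H : {poly padic_int p_pr},
  map_poly (fun m : int => m%:~R : padic_int p_pr) R = G * H ->
  size G = 1 \/ size H = 1.

(** A positive least minimizer [k] would give a factorization into positive degrees [k] and [d - k].
    Hence [k] is 0, where the slope bound is the claim. *)
Lemma single_slope : wdvd p d (v 0) (v 0 * d) R.
Proof.
have Rd : R`_d = 1 by move/monicP: Rm; rewrite /lead_coef sR.
have [k [kd Rk] [kmin kleast]] := lowest_slope_vertex.
have wR : wdvd p (d - k) (v k) (v k * d) R.
  apply: wdvd_valz => //; first by rewrite subn_gt0.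
  move=> i Ri; case: (ltngtP i d) => [id|di|->]; last exact: leq_addl.
    by rewrite addnC -leq_subLR -mulnBr [((d - k) * _)%N]mulnC kmin.
  by move: Ri; rewrite nth_default ?eqxx // sR.
case: (posnP k) => [k0|k0]; first by move: wR; rewrite k0 subn0.
have [q qR] : exists q, R`_k = q * p%:Z ^+ v k.
  by apply/dvdzP; rewrite dvdz_valz.
have pq : ~~ (p%:Z %| q)%Z.
  have : ~~ (p%:Z ^+ (v k).+1 %| R`_k)%Z by rewrite dvdz_valz // ltnn.
  by apply: contra => pq; rewrite [X in (_ %| X)%Z]qR exprS dvdz_mul.
(* The lifting starts from ['X^k] and [drop_poly k R]; the error is the part of [R] below [k], of
   strictly larger weight since [k] is the least minimizer. *)
have takeE : R - 'X^k * drop_poly k R = take_poly k R.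
  by rewrite -{1}(poly_take_drop k R) mulrC addrK.
have sH : size (drop_poly k R) = (d - k).+1.
  by rewrite size_drop_poly sR subSn // ltnW.
have [||||||G [H [RGH sG sH']]] := @weighted_hensel p p_pr k (d - k) (v k) q
    R (drop_poly k R) _ _ pq _ sH.
- by rewrite subn_gt0.
- by rewrite coef_drop_poly add0n mulrC -qR.
- by rewrite monicE /lead_coef sH coef_drop_poly /= subnK ?Rd // ltnW.
- by apply: wdvd_drop; rewrite -mulnDr subnK // ltnW.
- by rewrite takeE (leq_trans (size_take_poly _ _)) ?leq_addr.
- rewrite takeE subnKC ?(ltnW kd) //; apply: wdvd_valz; rewrite ?subn_gt0 // => i.
  rewrite coef_take_poly; case: ifP => // ik; rewrite ?eqxx // => Ri.
  rewrite -[in X in (X < _)%N](subnKC (ltnW (ltn_trans ik kd))) mulnDr addnC.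
  by rewrite ltn_add2r [((d - k) * _)%N]mulnC kleast.
by have := R_irr RGH; rewrite sG sH'; move: kd k0; clear; lia.
Qed.

End SingleSlope.

(** * Valuations of the shifted values *)

Section ShiftedValues.
Variables (p : nat) (p_pr : prime p) (R : {poly int}) (d a : nat).
Hypotheses (Rm : R \is monic) (sR : size R = d.+1).
Hypothesis wR : wdvd p d a (a * d) R.

Lemma dvdz_term t e h i : (p%:Z ^+ t %| h)%Z ->
  (forall m, a * d <= d * m + a * i -> e <= m + t * i)%N ->
  (p%:Z ^+ e %| R`_i * h ^+ i)%Z.
Proof.
move=> th em; have [m mR /em em'] := wR i.
apply: dvdz_trans (dvdz_exp2l _ em') _.
by rewrite exprD exprM dvdz_mul // dvdz_exp2r.
Qed.

(** Every lower term is divisible by [p ^ (d * t + 1)], so the leading term [h ^ d] alone decides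
    the valuation. *)
Lemma valz_far h : h != 0 -> (d * valz p h < a)%N ->
  valz p R.[h] = (d * valz p h)%N.
Proof.
move=> h0; set t := valz p h => dta.
have Rd : R`_d = 1 by move/monicP: Rm; rewrite /lead_coef sR.
have th : (p%:Z ^+ t %| h)%Z by rewrite dvdz_valz.
have hd n : (p%:Z ^+ n %| h ^+ d)%Z = (n <= d * t)%N.
  by rewrite dvdz_valz ?expf_neq0 // /valz abszX lognX.
rewrite horner_coef sR big_ord_recr /= Rd mul1r.
have low : (p%:Z ^+ (d * t).+1 %| \sum_(i < d) R`_i * h ^+ i)%Z.
  apply: rpred_sum => i _; apply: (dvdz_term th) => m am.
  by move: am dta (ltn_ord i); clear; nia.
apply: valz_eq => //; first by rewrite rpredD ?hd // (dvdz_trans _ low) ?dvdz_exp2l.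
by rewrite rpredDl // hd ltnn.
Qed.

(** Each term is divisible by [p ^ a], since [m + t * i >= a * (d - i) / d + a * i / d]. *)
Lemma valz_near t h : (a <= d * t)%N -> (p%:Z ^+ t %| h)%Z ->
  ~~ (p%:Z ^+ a.+1 %| R.[h])%Z -> valz p R.[h] = a.
Proof.
move=> adt th aR; apply: valz_eq => //.
rewrite horner_coef; apply: rpred_sum => i _; apply: (dvdz_term th) => m am.
have := ltn_ord i; rewrite [X in (_ < X)%N]sR; move: am adt; clear; nia.
Qed.

End ShiftedValues.

(** * The period length *)

Lemma ceil_ratio_leq (a d t : nat) : (0 < d)%N ->
  (`|Num.ceil (a%:R / d%:R : rat)| <= t)%N = (a <= d * t)%N.
Proof.
move=> d0.
have c0 : (0 : int) <= Num.ceil (a%:R / d%:R : rat).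
  by rewrite ceil_ge0 (lt_le_trans (ltrN10 _)) // divr_ge0 ?ler0n.
rewrite -lez_nat gez0_abs // ceil_le_int ler_pdivrMr ?ltr0n //.
by rewrite -natrM ler_nat mulnC.
Qed.

Theorem theorem5p1 (p : nat) (p_pr : prime p) (Q : {poly int}) (d alpha : nat)
    (Q_monic : Q \is monic) (Q_deg : size Q = d.+1) (d_ge2 : (2 <= d)%N)
    (Q_irr : irreducible_over_padic_int p_pr Q)
    (alphaP : largest (fun a => has_root_mod Q (p%:Z ^+ a)) alpha) :
  period_length (fun n : nat => valz p Q.[n%:Z])
    (p ^ `|Num.ceil (alpha%:R / d%:R : rat)|)%N.
Proof.
have d0 : (0 < d)%N by apply: ltnW.
case: alphaP => -[x0 Qx0] maxalpha.
(* In particular [Q] has no integer zero, so the junk value of [valz] never occurs among its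
   values. *)
have Qmax x : ~~ (p%:Z ^+ alpha.+1 %| Q.[x])%Z.
  apply/negP => /dvdz_mod0P Qx.
  suff : (alpha < alpha)%N by rewrite ltnn.
  by apply: maxalpha; exists x; rewrite Qx mod0z.
pose R := Q \Po ('X + x0%:P).
have RE h : R.[h] = Q.[h + x0] by rewrite horner_comp !hornerE.
have sR : size R = d.+1 by rewrite size_comp_poly2 ?size_XaddC.
have Rm : R \is monic.
  by rewrite monicE lead_coef_comp ?size_XaddC // lead_coefXaddC expr1n mulr1.
have R0E : R`_0 = Q.[x0] by rewrite -horner_coef0 RE add0r.
have vR0 : valz p R`_0 = alpha.
  by apply: valz_eq; rewrite // R0E //; apply/dvdz_mod0P; rewrite Qx0 mod0z.
have R0 : R`_0 != 0.
  by apply: contraNneq (Qmax x0); rewrite -R0E => ->; rewrite dvdz0.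
have wR : wdvd p d alpha (alpha * d) R.
  rewrite -vR0; apply: (@single_slope _ p_pr) => // G H.
  exact: irreducible_padic_shift.
set c := `|_|%N.
have cP t : (c <= t)%N = (alpha <= d * t)%N by apply: ceil_ratio_leq.
pose U (n : nat) := valz p Q.[n%:Z].
have QR (n : nat) : Q.[n%:Z] = R.[n%:Z - x0] by rewrite RE subrK.
have near (n : nat) : (p%:Z ^+ c %| n%:Z - x0)%Z -> U n = alpha.
  move=> cn; rewrite /U QR; apply: (valz_near p_pr sR wR _ cn).
    by rewrite -cP.
  by rewrite RE.
have far (n : nat) : ~~ (p%:Z ^+ c %| n%:Z - x0)%Z ->
    [/\ n%:Z - x0 != 0, (valz p (n%:Z - x0) < c)%N
      & U n = (d * valz p (n%:Z - x0))%N].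
  move=> cn; have n0 : n%:Z - x0 != 0.
    by apply: contraNneq cn => ->; rewrite dvdz0.
  have tc : (valz p (n%:Z - x0) < c)%N.
    by move: cn; rewrite dvdz_valz // -ltnNge.
  by split=> //; rewrite /U QR (valz_far p_pr Rm sR wR) // ltnNge -cP -ltnNge.
have shift (n T : nat) : (n + T)%N%:Z - x0 = n%:Z - x0 + T%:Z.
  by rewrite PoszD addrAC.
have dvdT (T : nat) : (p%:Z ^+ c %| T%:Z)%Z = (p ^ c %| T)%N.
  by rewrite dvdzE abszX.
split.
  split; first by rewrite expn_gt0 prime_gt0.
  move=> n; rewrite -![valz p _]/(U _).
  have cT : (p%:Z ^+ c %| (p ^ c)%N%:Z)%Z by rewrite dvdT.
  have same : (p%:Z ^+ c %| (n + p ^ c)%N%:Z - x0)%Z = (p%:Z ^+ c %| n%:Z - x0)%Z.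
    by rewrite shift rpredDr.
  have [cn|cn] := boolP (p%:Z ^+ c %| n%:Z - x0)%Z.
    by rewrite !near ?same.
  have [n0 tc ->] := far n cn.
  have [_ _ ->] := far (n + p ^ c)%N (eq_ind_r (fun b => ~~ b) cn same).
  (* The valuation of [n - x0] is below [c], so adding [p ^ c] preserves it. *)
  congr (_ * _)%N; apply: valz_eq => //.
    rewrite shift rpredD //; first by rewrite dvdz_valz.
    exact: dvdz_trans (dvdz_exp2l _ (ltnW tc)) cT.
  rewrite shift rpredDr; first by rewrite dvdz_valz // ltnn.
  exact: dvdz_trans (dvdz_exp2l _ tc) cT.
move=> S [S0 SP].
(* [x0] may be negative, so a natural representative of its class is needed. *)
have [n0 n0E] : exists n0 : nat, n0%:Z = (x0 %% p%:Z ^+ c)%Z.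
  exists `|(x0 %% p%:Z ^+ c)%Z|%N; rewrite gez0_abs // modz_ge0 //.
  by rewrite expf_neq0 //; have := prime_gt0 p_pr; lia.
have cn0 : (p%:Z ^+ c %| n0%:Z - x0)%Z.
  by rewrite -eqz_mod_dvd n0E modz_mod.
have : U (n0 + S)%N = alpha by rewrite -(near n0) //; exact: SP.
(* Off the class of [x0] the value is [d * t] with [t < c]; were it [alpha], [cP] would give
   [c <= t]. *)
have [|/far[_ tc ->] dta] := boolP (p%:Z ^+ c %| (n0 + S)%N%:Z - x0)%Z.
  by rewrite shift rpredDl // dvdT => cS _; apply: dvdn_leq.
by move: tc; rewrite ltnNge cP dta leqnn.
Qed.
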